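(* Let $P=(V,\prec)$ be a bipartite poset. Let $K$ be the set of height-1 elements of $P$ and $S$ the set of height-0 elements. Let $G$ be the graph on $V$ whose edges are the pairs $uv$ with $u\prec v$ in $P$ together with all pairs of distinct elements of $K$. Then $G$ is a split graph, and $G$ is an unbalanced split graph if and only if $P$ is unbalanced (equivalently, $G$ is balanced if and only if $P$ is balanced).
   Context: A bipartite poset is a finite poset of height at most one (no $x\prec y\prec z$). An element $v$ has height 1 if there is $u$ with $u\prec v$, and height 0 otherwise. A height-0 element is a full support point if it is comparable to every height-1 element. A bipartite poset is unbalanced if it contains a full support point and balanced otherwise. A finite graph $G$ is a split graph if its vertex set can be partitioned as $K\cup S$ with $K$ a clique and $S$ a stable set (a $KS$-partition); it is balanced if it has a $KS$-partition with $|K|=\omega(G)$ (clique number) and $|S|=\alpha(G)$ (independence number), and unbalanced otherwise. *)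

(* Defs.v *)
From HB Require Import structures.
From mathcomp Require Import all_boot all_order.

Set Implicit Arguments.
Unset Strict Implicit.
Unset Printing Implicit Defensive.

Import Order.TTheory.
Local Open Scope order_scope.

Record sgraph (V : finType) := SGraph {
  adj :> rel V;
  adj_sym : symmetric adj;
  adj_irr : irreflexive adj
}.

Section SplitGraphs.
Variables (V : finType) (G : sgraph V).
Implicit Types A K S : {set V}.

Definition clique A : bool :=
  [forall x in A, forall y in A, (x != y) ==> G x y].

Definition stable A : bool :=
  [forall x in A, forall y in A, ~~ G x y].

Definition clique_number : nat := (\max_(A : {set V} | clique A) #|A|)%N.

Definition independence_number : nat :=
  (\max_(A : {set V} | stable A) #|A|)%N.

(* Either part may be empty. *)
Definition KS_partition K S : Prop :=
  [/\ K :|: S = [set: V], [disjoint K & S], clique K & stable S].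

Definition split_graph : Prop := exists K S, KS_partition K S.

Definition balanced_split_graph : Prop :=
  exists K S, [/\ KS_partition K S,
                  #|K| = clique_number & #|S| = independence_number].

Definition unbalanced_split_graph : Prop :=
  split_graph /\ ~ balanced_split_graph.

End SplitGraphs.

Section BipartitePosets.
Variables (disp : Order.disp_t) (V : finPOrderType disp).
Implicit Types u v w x y : V.

Definition bipartite_poset : Prop := forall x y z : V, ~ (x < y /\ y < z).

Definition height1 v : bool := [exists u : V, u < v].
Definition height0 v : bool := ~~ height1 v.

Definition full_support_point v : Prop :=
  height0 v /\ forall w, height1 w -> v >=< w.

Definition unbalanced_poset : Prop := exists v, full_support_point v.
Definition balanced_poset : Prop := ~ unbalanced_poset.

Definition poset_adj : rel V := fun x y =>
  [|| x < y, y < x | [&& height1 x, height1 y & x != y]].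

Lemma poset_adj_sym : symmetric poset_adj.
Proof.
by move=> x y; rewrite /poset_adj orbCA andbCA eq_sym.
Qed.

Lemma poset_adj_irr : irreflexive poset_adj.
Proof. by move=> x; rewrite /poset_adj ltxx eqxx !andbF. Qed.

Definition poset_graph : sgraph V := SGraph poset_adj_sym poset_adj_irr.

End BipartitePosets.

Arguments bipartite_poset {disp} V.
Arguments unbalanced_poset {disp} V.
Arguments balanced_poset {disp} V.
Arguments poset_graph {disp} V.

(* Main.v *)
(* Write K, S for the height-1 and height-0 elements.  A clique and a stable set
   share at most one vertex.  Hence a stable set A leaving S does so in a single
   k in K and then misses an element of S below k, so S is always a maximum
   stable set.  Likewise a clique leaving K does so in a single s in S, and
   unless s is a full support point it misses some element of K, so K is a
   maximum clique when P is balanced.  If s is a full support point then s + K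
   is a clique, so omega + alpha > |V|, which no balanced split graph allows. *)
Require Import Defs.
From HB Require Import structures.
From mathcomp Require Import all_boot all_order.

Set Implicit Arguments.
Unset Strict Implicit.
Unset Printing Implicit Defensive.

Import Order.TTheory.

Section SplitGraphTheory.
Variables (V : finType) (G : sgraph V).
Implicit Types A K S : {set V}.

Lemma cliqueP A :
  reflect {in A &, forall x y, x != y -> G x y} (clique G A).
Proof.
apply: (iffP forall_inP) => [h x y xA yA xy | h x xA].
  by move/forall_inP: (h x xA) => /(_ y yA)/implyP; apply.
by apply/forall_inP => y yA; apply/implyP; apply: h.
Qed.

Lemma stableP A : reflect {in A &, forall x y, ~~ G x y} (stable G A).
Proof.
apply: (iffP forall_inP) => [h x y xA yA | h x xA].
  by move/forall_inP: (h x xA) => /(_ y yA).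
by apply/forall_inP => y; apply: h.
Qed.

Lemma clique_stable_eq A S x y : clique G A -> stable G S ->
  x \in A -> x \in S -> y \in A -> y \in S -> x = y.
Proof.
move=> /cliqueP cA /stableP sS xA xS yA yS.
apply: contraTeq (sS x y xS yS); rewrite negbK; exact: cA.
Qed.

Lemma card_clique_le A : clique G A -> #|A| <= clique_number G.
Proof. by move=> cA; apply: (bigop.bigmax_sup A). Qed.

Lemma card_stable_le A : stable G A -> #|A| <= independence_number G.
Proof. by move=> sA; apply: (bigop.bigmax_sup A). Qed.

Lemma clique_numberE K : clique G K ->
  (forall A, clique G A -> #|A| <= #|K|) -> #|K| = clique_number G.
Proof.
move=> cK maxK; apply/eqP; rewrite eqn_leq card_clique_le //=.
exact/bigop.bigmax_leqP.
Qed.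

Lemma independence_numberE S : stable G S ->
  (forall A, stable G A -> #|A| <= #|S|) -> #|S| = independence_number G.
Proof.
move=> sS maxS; apply/eqP; rewrite eqn_leq card_stable_le //=.
exact/bigop.bigmax_leqP.
Qed.

Lemma KS_partitionNl K S x : KS_partition G K S -> x \notin K -> x \in S.
Proof.
case=> KS _ _ _ /negbTE xK.
by have := in_setT x; rewrite -KS in_setU xK.
Qed.

Lemma KS_partitionNr K S x : KS_partition G K S -> x \notin S -> x \in K.
Proof. by move=> KS; apply: contraR; apply: KS_partitionNl KS. Qed.

Lemma KS_partition_card K S : KS_partition G K S -> #|K| + #|S| = #|V|.
Proof.
case=> KS dKS _ _.
by rewrite -cardsT -KS cardsU disjoint_setI0 // cards0 subn0.
Qed.

(** This serves for a set [A] that leaves [K] only in [x] and omits [y]: trading [x] for [y] moves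
    [A] into [K] without changing its size. *)
Lemma card_exchange A K x y :
  x \in A -> y \in K -> A :\ x \subset K :\ y -> #|A| <= #|K|.
Proof.
by move=> xA yK /subset_leq_card; rewrite (cardsD1 x A) (cardsD1 y K) xA yK.
Qed.

Lemma KS_clique_max K S : KS_partition G K S ->
  {in S, forall s, exists2 k, k \in K & ~~ G s k} ->
  #|K| = clique_number G.
Proof.
move=> KS nS; have [_ _ cK sS] := KS.
apply: clique_numberE => // A cA.
have [/subset_leq_card //|/subsetPn[s sA sNK]] := boolP (A \subset K).
have sinS := KS_partitionNl KS sNK; have [k kK Gsk] := nS s sinS.
apply: (card_exchange sA kK); apply/subsetP => x; rewrite !inE => /andP[xs xA].
apply/andP; split.
  (* If [x] were [k], the clique [A] would make [s] and [k] adjacent. *)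
  apply: contraNneq Gsk => <-; move/cliqueP: cA; apply=> //.
  by rewrite eq_sym.
(* If [x] were in [S], the clique [A] would meet the stable set [S] in both [x] and [s], forcing
   [x = s]. *)
apply: (KS_partitionNr KS); apply: contra xs => xS.
by rewrite (clique_stable_eq cA sS xA xS sA sinS).
Qed.

Lemma KS_stable_max K S : KS_partition G K S ->
  {in K, forall k, exists2 s, s \in S & G k s} ->
  #|S| = independence_number G.
Proof.
move=> KS nK; have [_ _ cK sS] := KS.
apply: independence_numberE => // A sA.
have [/subset_leq_card //|/subsetPn[k kA kNS]] := boolP (A \subset S).
have kK := KS_partitionNr KS kNS; have [s sinS Gks] := nK k kK.
apply: (card_exchange kA sinS); apply/subsetP => x.
rewrite !inE => /andP[xk xA]; apply/andP; split.
  by apply: contraTneq Gks => <-; move/stableP: sA; apply.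
apply: (KS_partitionNl KS); apply: contra xk => xK.
by rewrite (clique_stable_eq cK sA xK xA kK kA).
Qed.

(** The left side no longer mentions the partition that witnesses balance, so the equation can be
    tested against any other KS-partition. *)
Lemma balanced_split_graph_card : balanced_split_graph G ->
  clique_number G + independence_number G = #|V|.
Proof. by case=> K [S [/KS_partition_card <- -> ->]]. Qed.

End SplitGraphTheory.

Section PosetGraph.
Variables (disp : Order.disp_t) (V : finPOrderType disp).
Hypothesis bipV : bipartite_poset V.

Let K := [set v : V | height1 v].
Let S := [set v : V | height0 v].

(** Bipartiteness enters here: a [w] below [u] would complete a chain [w < u < v]. *)
Lemma height0_lt (u v : V) : (u < v)%O -> height0 u.
Proof.
by move=> uv; apply/existsP => -[w wu]; apply: (bipV (conj wu uv)).
Qed.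

Lemma height0_not_gt (u v : V) : height0 v -> (u < v)%O = false.
Proof. by move=> hv; apply/negP => uv; case/existsP: hv; exists u. Qed.

Lemma poset_graph_KS_partition : KS_partition (poset_graph V) K S.
Proof.
have SE : S = ~: K by apply/setP => x; rewrite !inE.
split; rewrite ?SE ?setUCr //; first by rewrite -setI_eq0 setICr.
  apply/cliqueP => x y; rewrite !inE /= /poset_adj => -> -> ->.
  by rewrite !orbT.
apply/stableP => x y; rewrite -SE !inE /= /poset_adj => hx hy.
by rewrite !height0_not_gt //= (negbTE hx).
Qed.

Lemma poset_graph_independence_number :
  #|S| = independence_number (poset_graph V).
Proof.
apply: (KS_stable_max poset_graph_KS_partition) => k; rewrite inE.
case/existsP=> s sk; exists s; first by rewrite inE; apply: height0_lt sk.
by rewrite /= /poset_adj sk orbT.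
Qed.

Lemma balanced_poset_graph : balanced_poset V ->
  balanced_split_graph (poset_graph V).
Proof.
move=> balV; exists K, S; split; [exact: poset_graph_KS_partition | |
  exact: poset_graph_independence_number].
apply: (KS_clique_max poset_graph_KS_partition) => s; rewrite inE => hs.
have [/existsP[k /andP[hk sk]]|/existsPn nk] :=
    boolP [exists k : V, height1 k && ~~ (s >=< k)%O]; last first.
  by case: balV; exists s; split=> // w hw; have := nk w; rewrite hw negbK.
(* As [s] has height 0, the clause joining height-1 elements fails, and adjacency to [s] implies
   comparability. *)
exists k; rewrite ?inE //= /poset_adj (negbTE hs) orbF.
by apply: contra sk => /orP[] /ltW le; rewrite /Order.comparable le ?orbT.
Qed.

Lemma unbalanced_poset_graph : unbalanced_poset V ->
  ~ balanced_split_graph (poset_graph V).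
Proof.
case=> s [hs full] /balanced_split_graph_card.
have sNK : s \notin K by rewrite inE.
have adjs k : k \in K -> poset_graph V s k.
  (* Comparability allows equality, so strictness has to come from the different heights of [s] and
     [k]. *)
  rewrite inE /= => hk; have sk : s != k by apply: contraTneq hk => <-.
  have := full k hk; rewrite /poset_adj /Order.comparable !le_eqVlt.
  by rewrite [k == s]eq_sym (negbTE sk) => /orP[] /= ->; rewrite ?orbT.
have [_ _ /cliqueP cK _] := poset_graph_KS_partition.
have cKs : clique (poset_graph V) (s |: K).
  apply/cliqueP => x y /setU1P[->|xK] /setU1P[->|yK].
  - by rewrite eqxx.
  - by move=> _; apply: adjs.
  - by move=> _; rewrite adj_sym; apply: adjs.
  - exact: cK.
have := card_clique_le cKs; rewrite cardsU1 sNK add1n => Klt.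
(* Since [#|S|] is the independence number, cancelling it in the cardinality equation leaves a
   clique number equal to [#|K|], against [Klt]. *)
rewrite -(KS_partition_card poset_graph_KS_partition).
rewrite -poset_graph_independence_number => /addIn wE.
by rewrite wE ltnn in Klt.
Qed.

End PosetGraph.

Theorem theorem4p3 (disp : Order.disp_t) (V : finPOrderType disp)
    (bipV : bipartite_poset V) :
  [/\ split_graph (poset_graph V),
      unbalanced_split_graph (poset_graph V) <-> unbalanced_poset V
    & balanced_split_graph (poset_graph V) <-> balanced_poset V].
Proof.
have splitV : split_graph (poset_graph V).
  by do 2!eexists; apply: poset_graph_KS_partition.
have unbal := unbalanced_poset_graph bipV.
have bal := balanced_poset_graph bipV.
split=> //; last by split=> // balG unbV; apply: unbal unbV balG.
split=> [[_ nbal] | unbV]; last by split=> //; apply: unbal.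
(* From [nbal] and [bal] one only gets that [V] is not balanced, a double negation. Finiteness makes
   the existence of a full support point a boolean, for which proof by contradiction is
   available. *)
suff /existsP[v /andP[hv /forallP full]] : [exists v : V, height0 v &&
    [forall w : V, height1 w ==> (v >=< w)%O]].
  by exists v; split=> // w; apply/implyP.
apply: contraPT isT => nfull _; apply/nbal/bal => -[v [hv full]].
case/negP: nfull; apply/existsP; exists v; rewrite hv /=.
by apply/forallP => w; apply/implyP/full.
Qed.
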